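(* Let $K$ be a field, let $1\le t\le n$ be integers, $R=K[x_1,\dots,x_n]$, let $I_{n,t}\subseteq R$ be the $t$-path ideal of the path graph $P_n$, and let $\Gamma_{n,t}$ be its facet complex. Then for every integer $k$ with $1\le k\le\nu(\Gamma_{n,t})$, the Krull dimension of $R/I_{n,t}^{[k]}$ is $$\dim\left(R/I_{n,t}^{[k]}\right)=n-\left\lfloor\frac{n}{t}\right\rfloor+k-1.$$
   Context: $P_n$ is the path graph on $\{1,\dots,n\}$ with edges $\{i,i+1\}$. The $t$-path ideal $I_{n,t}$ of $P_n$ is generated by $x_ix_{i+1}\cdots x_{i+t-1}$ for $1\le i\le n-t+1$. The facet complex $\Gamma_{n,t}$ of $I_{n,t}$ is the simplicial complex with facets $\{i,\dots,i+t-1\}$, $1\le i\le n-t+1$; $\nu(\Gamma_{n,t})$ is the maximum number of pairwise disjoint facets of $\Gamma_{n,t}$. The $k$-th squarefree power $I^{[k]}$ of a squarefree monomial ideal $I$ is generated by the squarefree monomials in the minimal monomial generating set of $I^k$; for $I=I_{n,t}$ it is generated by the products of $k$ generators of $I_{n,t}$ with pairwise disjoint supports. *)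

(* Defs.v *)
From HB Require Import structures.
From mathcomp Require Import all_boot all_order all_algebra.
From mathcomp Require Import boolp.
From mathcomp Require Import freeg mpoly.

Set Implicit Arguments.
Unset Strict Implicit.
Unset Printing Implicit Defensive.

Import GRing.Theory.
Local Open Scope ring_scope.

Section Ideals.
Variable R : comNzRingType.
Implicit Types S I : {pred R}.

Definition ideal_span S : {pred R} := [pred f | `[<
  exists2 s : seq (R * R),
    all (fun q => q.2 \in S) s & f = \sum_(q <- s) q.1 * q.2 >]].

Definition ideal_exp I k : {pred R} := ideal_span [pred f | `[<
  exists2 s : k.-tuple R, all (mem I) s & f = \prod_(a <- s) a >]].

Lemma ideal_span_min S (P : {pred R}) :
  idealr_closed P -> {subset S <= P} -> {subset ideal_span S <= P}.
Proof.
move=> [P0 _ Plin] sSP f /asboolP[s sS ->].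
elim: s sS => [_|q s IHs /= /andP[qS /IHs sP]]; first by rewrite big_nil.
by rewrite big_cons; apply: Plin => //; apply: sSP.
Qed.

Lemma ideal_span_closed S (P : {pred R}) :
  idealr_closed P -> {subset S <= P} -> idealr_closed (ideal_span S).
Proof.
move=> Pideal sSP; split.
- by apply/asboolP; exists [::]; rewrite ?big_nil.
- by have [_ + _] := Pideal; apply: contra; apply: ideal_span_min.
- move=> a _ _ /asboolP[s sS ->] /asboolP[r rS ->]; apply/asboolP.
  exists ([seq (a * q.1, q.2) | q <- s] ++ r).
    by rewrite all_cat rS andbT all_map.
  rewrite big_cat big_map mulr_sumr; congr (_ + _).
  by apply: eq_bigr => q _; rewrite mulrA.
Qed.

Lemma ideal_exp_min I (P : {pred R}) k : idealr_closed P -> {subset I <= P} -> (0 < k)%N ->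
  {subset ideal_exp I k <= P}.
Proof.
move=> Pideal sIP; case: k => // k _; apply: ideal_span_min => // f.
move=> /asboolP[s + ->]; case: (tupleP s) => a {}s /= /andP[aI _].
have [P0 _ Plin] := Pideal.
by rewrite big_cons mulrC -[_ * a]addr0; apply: Plin => //; apply: sIP.
Qed.

Definition idealr_of S (Sideal : idealr_closed S) : idealr R :=
  HB.pack_for (idealr R) S (isIdealr.Build R S Sideal).

Definition prime_ideal (P : {pred R}) := idealr_closed P /\ prime_idealr_closed P.

(* P 0 < P 1 < ... < P d; the values P i for i > d are irrelevant *)
Definition prime_chain (d : nat) (P : nat -> {pred R}) :=
  (forall i, (i <= d)%N -> prime_ideal (P i)) /\
  (forall i, (i < d)%N ->
     {subset P i <= P i.+1} /\ exists2 x, x \in P i.+1 & x \notin P i).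

Definition is_krull_dim (d : nat) :=
  (exists P, prime_chain d P) /\
  (forall m P, prime_chain m P -> (m <= d)%N).

End Ideals.

Section MonomialIdeals.
Variables (K : fieldType) (n : nat).
Implicit Types (I J : {pred {mpoly K[n]}}) (m : 'X_{1..n}).

(* G(J) for a monomial ideal J: the monomials of J minimal for divisibility,
   which is the (unique) minimal set of monomials generating J *)
Definition min_mon_gen J : {pred 'X_{1..n}} := [pred m |
  `[< 'X_[m] \in J /\
      forall m', 'X_[m'] \in J -> (m' <= m)%MM -> m' = m >]].

Definition squarefree_mnm m := [forall i, (m i <= 1)%N].

Definition squarefree_power I k : {pred {mpoly K[n]}} :=
  ideal_span [pred f | `[< exists m,
    [/\ m \in min_mon_gen (ideal_exp I k), squarefree_mnm m & f = 'X_[m]] >]].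

(* The library's quotient rings are by proper ideals only; this ideal, the
   kernel of evaluation at 0, is used to show that the ideals below are proper. *)
Definition no_const_ideal : {pred {mpoly K[n]}} := [pred p | p@_0%MM == 0].

Lemma no_const_ideal_closed : idealr_closed no_const_ideal.
Proof.
split; rewrite ?inE ?mcoeff0 // ?mcoeff1 ?eqxx ?oner_eq0 //.
move=> a u v; rewrite !inE => /eqP u0 /eqP v0.
by rewrite mcoeffD v0 addr0 rmorphM /= u0 mulr0.
Qed.

Lemma squarefree_power_closed I k :
  {subset I <= no_const_ideal} -> (0 < k)%N ->
  idealr_closed (squarefree_power I k).
Proof.
move=> sI k0; apply: (ideal_span_closed no_const_ideal_closed).
move=> f /asboolP[m [/asboolP[mI _] _ ->]].
exact: (ideal_exp_min no_const_ideal_closed sI k0).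
Qed.

End MonomialIdeals.

Section SimplicialComplexes.
Variable T : finType.
Implicit Types D M : {set {set T}}.

Definition complex_of_facets M : {set {set T}} :=
  [set F : {set T} | [exists G in M, F \subset G]].

Definition facets D : {set {set T}} := [set F : {set T} | maxset (mem D) F].

Definition matching_number D : nat :=
  \max_(M : {set {set T}} | (M \subset facets D) && trivIset M) #|M|.

End SimplicialComplexes.

(* The vertices of the path graph are 0, ..., n-1 instead of 1, ..., n. *)
Section PathIdeals.
Variables (K : fieldType) (n t : nat).

Definition path_facet (i : nat) : {set 'I_n} := [set j : 'I_n | (i <= j < i + t)%N].

Definition path_complex : {set {set 'I_n}} :=
  complex_of_facets [set path_facet i | i : 'I_(n.+1 - t)].

Definition path_ideal : {pred {mpoly K[n]}} :=
  ideal_span [pred f |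
    [exists i : 'I_(n.+1 - t), f == \prod_(j in path_facet i) 'X_j]].

Lemma path_ideal_no_const :
  (0 < t)%N -> {subset path_ideal <= @no_const_ideal K n}.
Proof.
move=> t0; apply: ideal_span_min; first exact: no_const_ideal_closed.
move=> f /existsP[i /eqP->].
have lt_in : (i < n)%N.
  have := ltn_ord i; rewrite ltn_subRL addnC ltnS; apply: leq_trans.
  by rewrite -addn1 leq_add2l.
have [_ _ Plin] := no_const_ideal_closed K n.
have i_facet : Ordinal lt_in \in path_facet i.
  by rewrite inE /= leqnn -addn1 leq_add2l.
rewrite (bigD1 _ i_facet) /= mulrC -[_ * 'X__]addr0.
by apply: Plin; rewrite /no_const_ideal inE ?mcoeff0 // mcoeffX mnm1_eq0.
Qed.

Definition path_squarefree_power k (t_gt0 : (0 < t)%N) (k_gt0 : (0 < k)%N) :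
    idealr {mpoly K[n]} :=
  idealr_of (squarefree_power_closed (path_ideal_no_const t_gt0) k_gt0).

End PathIdeals.

(* Main.v *)
(* Put q = n %/ t.  Every facet contains exactly one of the q vertices closing the
   consecutive blocks of length t, so any q - k + 1 of these vertices generate a prime
   containing the squarefree power: its monomials meet at least k of the q vertices.
   Adding the remaining variables one by one gives a chain of the required length.
   Conversely, a prime containing the squarefree power contains a variable of all but
   at most k - 1 of the q disjoint blocks, and a chain of primes starting above a set
   of variables C has length at most n - #|C|. *)
Require Import Defs.
From mathcomp Require Import all_boot all_order all_algebra.
From mathcomp Require Import freeg mpoly zify boolp.

Set Implicit Arguments.
Unset Strict Implicit.
Unset Printing Implicit Defensive.

Import GRing.Theory.
Local Open Scope ring_scope.

(** * Closure properties of ideals and primes *)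

Section IdealClosure.
Variables (R : comNzRingType) (P : {pred R}).
Hypothesis idealP : idealr_closed P.

Lemma idealr_closedD u v : u \in P -> v \in P -> u + v \in P.
Proof. by move=> uP vP; have [_ _ /(_ 1 u v uP vP)] := idealP; rewrite mul1r. Qed.

Lemma idealr_closedM a u : u \in P -> a * u \in P.
Proof.
by move=> uP; have [P0 _ /(_ a u 0 uP P0)] := idealP; rewrite addr0.
Qed.

Lemma idealr_closed_sum (I : Type) (r : seq I) (A : pred I) (F : I -> R) :
  (forall i, A i -> F i \in P) -> \sum_(i <- r | A i) F i \in P.
Proof.
move=> FP; have [P0 _ _] := idealP.
by apply: (big_ind (fun u => u \in P)) => // u v; apply: idealr_closedD.
Qed.

Lemma idealr_closed_addl u v : v \in P -> u + v \in P -> u \in P.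
Proof.
move=> vP uvP; have -> : u = (u + v) + (-1) * v by rewrite mulN1r addrK.
by apply: idealr_closedD => //; apply: idealr_closedM.
Qed.

End IdealClosure.

Lemma mem_ideal_span (R : comNzRingType) (S : {pred R}) f :
  f \in S -> f \in ideal_span S.
Proof.
move=> fS; apply/asboolP; exists [:: (1, f)]; first by rewrite /= fS.
by rewrite big_seq1 mul1r.
Qed.

Section PrimeIdeals.
Variables (R : comNzRingType) (P : {pred R}).
Hypothesis primeP : prime_ideal P.

Lemma prime_ideal_cancelX x y j : x \notin P -> x ^+ j * y \in P -> y \in P.
Proof.
move=> xNP; have [_ prP] := primeP.
by elim: j => [|j IHj]; rewrite ?mul1r // exprS -mulrA => /prP; rewrite (negPf xNP).
Qed.

Lemma prime_ideal_prod (I : finType) (A : pred I) (F : I -> R) :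
  \prod_(i | A i) F i \in P -> exists2 i, A i & F i \in P.
Proof.
have [[_ P1 _] prP] := primeP.
suff: forall r : seq I, \prod_(i <- r | A i) F i \in P ->
    exists2 i, A i & F i \in P by exact.
elim=> [|i r IHr]; first by rewrite big_nil (negPf P1).
by rewrite big_cons; case: ifP => // Ai /prP/orP[FiP|/IHr]; first by exists i.
Qed.

End PrimeIdeals.

(** * Bounding the length of a chain of primes *)

(* Elements x_i of P_{i+1} outside P_i satisfy no nonzero polynomial relation
   modulo P_0: group a relation by the exponent j of x_0, cancel the lowest power
   of x_0 by primality, and read the rest modulo P_1 where x_0 vanishes. *)
Lemma chain_independent (K : fieldType) (R : comAlgType K) (N l : nat)
    (P : nat -> {pred R}) (x : l.-tuple R) (c : l.-tuple 'I_N -> K) :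
    (forall i, (i <= l)%N -> prime_ideal (P i)) ->
    (forall i, (i < l)%N ->
       [/\ {subset P i <= P i.+1}, x`_i \in P i.+1 & x`_i \notin P i]) ->
    \sum_a c a *: \prod_(i < l) tnth x i ^+ tnth a i \in P 0%N ->
  forall a, c a = 0.
Proof.
elim: l P x c => [|l IHl] P x c prP chainP sumP a.
  have [idP _] := prP 0%N (leqnn _).
  (* With no elements left the sum is the constant [c a]; were it nonzero, its inverse would bring 1
     into [P 0]. *)
  apply/eqP; apply: contraT => ca0; have [_ /negP P1 _] := idP; case: P1.
  rewrite (bigD1 a) //= big_ord0 big1 ?addr0 in sumP; last first.
    by move=> b; rewrite tuple0 (tuple0 a) eqxx.
  have := idealr_closedM idP ((c a)^-1)%:A sumP.
  by rewrite mulr_algl scalerA mulVf // scale1r.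
case: (tupleP x) chainP sumP => x0 {}x chainP sumP.
pose cc (j : 'I_N) (b : l.-tuple 'I_N) := c [tuple of j :: b].
pose G j := \sum_b cc j b *: \prod_(i < l) tnth x i ^+ tnth b i.
rewrite (_ : \sum_a _ = \sum_(j < N) x0 ^+ j * G j) in sumP; last first.
  rewrite (reindex (fun p : 'I_N * l.-tuple 'I_N => [tuple of p.1 :: p.2])) /=.
    rewrite -(pair_bigA _ (fun j (b : l.-tuple 'I_N) => c [tuple of j :: b] *:
       \prod_(i < l.+1) tnth [tuple of x0 :: x] i ^+ tnth [tuple of j :: b] i)) /=.
    apply: eq_bigr => j _; rewrite mulr_sumr; apply: eq_bigr => b _.
    rewrite big_ord_recl !tnth0 -scalerAr; congr (_ *: (_ * _)).
    by apply: eq_bigr => i _; rewrite !tnthS.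
  exists (fun b : l.+1.-tuple 'I_N => (thead b, [tuple of behead b])) => b _ /=.
    by case: b => j b; rewrite theadE; congr pair; apply: val_inj.
  by rewrite -tuple_eta.
have [P01 x0P1 x0NP0] := chainP 0%N isT.
have prP0 := prP 0%N isT; have [idP1 _] := prP 1%N isT.
(* The exponents of [x0] are treated in increasing order, so that [G i = 0] for every [i < j] when
   [j] is reached. *)
suff cc0 : forall m (j : 'I_N), (j < m)%N -> forall b, cc j b = 0.
  by case: (tupleP a) => j b; apply: (cc0 N).
elim=> // m IHm j; rewrite ltnS leq_eqVlt => /predU1P[jm|/IHm//].
apply: (IHl (fun i => P i.+1) x (cc j)) => [i il|i il|]; first exact: prP.
  exact: (chainP i.+1 il).
have G0 (i : 'I_N) : (i < j)%N -> G i = 0.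
  by rewrite jm => im; apply: big1 => b _; rewrite IHm ?scale0r.
have sumE : \sum_(i < N) x0 ^+ i * G i
    = x0 ^+ j * \sum_(i < N | (j <= i)%N) x0 ^+ (i - j) * G i.
  rewrite mulr_sumr [RHS]big_mkcond /=; apply: eq_bigr => i _.
  by case: leqP => [ji|/G0->]; rewrite ?mulr0 // mulrA -exprD subnKC.
rewrite sumE in sumP.
(* After cancelling [x0 ^+ j], each term with [i > j] keeps a factor [x0] and so lies in [P 1]; what
   remains is [G j]. *)
have := P01 _ (prime_ideal_cancelX prP0 x0NP0 sumP).
rewrite (bigD1 j) //= subnn mul1r; apply: (idealr_closed_addl idP1).
apply: (idealr_closed_sum idP1) => i /andP[ji ij].
rewrite -(subnSK (_ : j < i)%N); last by rewrite ltn_neqAle eq_sym -val_eqE in ij *; rewrite ij.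
by rewrite exprSr -mulrA mulrC -mulrA mulrC -mulrA; do !apply: (idealr_closedM idP1).
Qed.

Lemma mdeg_prod_le (K : fieldType) (n : nat) (I : finType)
    (F : I -> {mpoly K[n]}) (d : I -> nat) :
    (forall i, {in msupp (F i), forall m, mdeg m <= d i}%N) ->
  {in msupp (\prod_i F i), forall m, mdeg m <= \sum_i d i}%N.
Proof.
move=> Fd; apply: (big_ind2 (fun p e => {in msupp p, forall m, mdeg m <= e}%N)) => //.
  by move=> m; rewrite msupp1 inE => /eqP->; rewrite mdeg0.
move=> p a q b pa qb m /msuppM_le/allpairsP[[m1 m2] /= [m1p m2q ->]].
by rewrite mdegD leq_add ?pa ?qb.
Qed.

Lemma mdeg_exp_le (K : fieldType) (n : nat) (p : {mpoly K[n]}) (d e : nat) :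
  {in msupp p, forall m, mdeg m <= d}%N ->
  {in msupp (p ^+ e), forall m, mdeg m <= e * d}%N.
Proof.
move=> pd m; rewrite -[e in p ^+ e]card_ord -prodr_const => /mdeg_prod_le.
by move/(_ (fun=> d) (fun=> pd)); rewrite sum_nat_const card_ord.
Qed.

(* The N^l products of powers < N of l elements span a space of dimension at most
   O(N)^#|~: C| modulo the variables in C, so for large N they are dependent
   whenever #|~: C| < l. *)
Lemma chain_length_le (K : fieldType) (n l : nat)
    (P : nat -> {pred {mpoly K[n]}}) (C : {set 'I_n}) :
  prime_chain l P -> (forall i, i \in C -> 'X_i \in P 0%N) -> (l <= #|~: C|)%N.
Proof.
move=> [prP chainP] CP; rewrite leqNgt; apply/negP => ltCl.
have /choice[x xP] : forall i : 'I_l, exists y, y \in P i.+1 /\ y \notin P i.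
  by move=> i; have [_ [y yP yNP]] := chainP i (ltn_ord i); exists y.
(* [D] bounds the degree of each [x i] and [B] that of each product [f a]. The choice of [c] gives
   [B.+1 <= c * N], and that of [N] makes it exceed [c ^ #|~: C|]. *)
pose D := (\sum_i msize (x i))%N.
pose c := (l * D).+1; pose N := (c ^ #|~: C|).+1; pose B := (l * D * N)%N.
pose J := pffun_on (0 : 'I_B.+1) (mem (~: C)) predT.
pose f (a : l.-tuple 'I_N) := \prod_(i < l) x i ^+ tnth a i.
have f_deg a : {in msupp (f a), forall m, mdeg m <= B}%N.
  move=> m /(@mdeg_prod_le _ _ _ _ (fun=> N * D)%N) mB.
  apply: leq_trans (mB _) _; last by rewrite sum_nat_const card_ord /B; lia.
  move=> i {mB}m /(@mdeg_exp_le _ _ _ D) mD; apply: leq_trans (mD _) _.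
    move=> k /msize_mdeg_lt kx; apply: ltnW; apply: leq_trans kx _.
    by rewrite /D (bigD1 i) //= leq_addr.
  by rewrite leq_mul2r (ltnW (ltn_ord _)) orbT.
(* Row [a] lists the coefficients of [f a] at the monomials free of [C] with exponents at most [B].
   Independent rows will contradict the count of columns. *)
pose A := \matrix_(a < #|{: l.-tuple 'I_N}|, j < #|J|)
  (f (enum_val a))@_[multinom enum_val j i : nat | i < n].
have : row_free A.
  apply: inj_row_free => v vA0.
  have [idP _] := prP 0%N isT.
  (* A combination of rows that vanishes leaves only monomials divisible by a variable of [C], and
     these lie in [P 0]. *)
  have xP0 : \sum_b v 0 (enum_rank b) *: f b \in P 0%N.
    rewrite [X in X \in _]mpolyE big_seq; apply: (idealr_closed_sum idP) => m.
    rewrite mcoeff_msupp => m_supp.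
    have [i iC mi0] : exists2 i, i \in C & (0 < m i)%N.
      apply/exists_inP; apply: contraR m_supp; rewrite negb_exists_in.
      move=> /forall_inP mC0.
      (* [inord] returns the true exponents only up to [B]; a monomial of degree above [B] occurs in
         no [f b] and is treated apart. *)
      pose g := [ffun i => inord (m i) : 'I_B.+1].
      have gJ : g \in J.
        apply/pffun_onP; split=> // ; apply/subsetP => i; rewrite !inE ffunE.
        by apply: contraNN => /mC0; rewrite lt0n negbK => /eqP->; apply/eqP/val_inj; rewrite /= inordK.
      have [mB|mB] := leqP (mdeg m) B; last first.
        rewrite raddf_sum big1 // => b _ /=; rewrite mcoeffZ memN_msupp_eq0 ?mulr0 //.
        by apply/negP => /f_deg; rewrite leqNgt mB.
      have gm : [multinom g i : nat | i < n] = m.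
        apply/mnmP => i; rewrite mnmE ffunE inordK // ltnS.
        by apply: leq_trans mB; rewrite mdegE (bigD1 i) //= leq_addr.
      have /matrixP/(_ 0 (enum_rank_in gJ g)) := vA0.
      rewrite !mxE => vA0g; apply/eqP; rewrite -[RHS]vA0g raddf_sum /=.
      rewrite (reindex_onto enum_val enum_rank) /=; last by move=> b _; rewrite enum_rankK.
      apply: eq_big => [b|b _]; first by rewrite enum_valK eqxx.
      by rewrite mcoeffZ enum_valK mxE enum_rankK_in // gm.
    rewrite -mul_mpolyC; apply: (idealr_closedM idP).
    have -> : m = (m - U_(i) + U_(i))%MM.
      by apply/mnmP => j; rewrite mnmDE mnmBE mnm1E; case: eqP => [<-|_]; rewrite ?subnK ?subn0 ?addn0.
    by rewrite mpolyXD; apply: (idealr_closedM idP); apply: CP.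
  have v0 := @chain_independent K {mpoly K[n]} N l P [tuple x i | i < l]
    (fun b => v 0 (enum_rank b)) prP.
  apply/rowP => a; rewrite mxE -(enum_valK a); apply: v0.
    move=> i il; have [sP _] := chainP i il; have [xi xNi] := xP (Ordinal il).
    by rewrite -(tnth_nth 0 _ (Ordinal il)) tnth_mktuple.
  rewrite [X in X \in _](_ : _ = \sum_b v 0 (enum_rank b) *: f b) //.
  apply: eq_bigr => b _; congr (_ *: _).
  by apply: eq_bigr => i _; rewrite tnth_mktuple.
move/eqP => rkA; have := rank_leq_col A; rewrite rkA card_tuple card_ord.
rewrite card_pffun_on card_ord leqNgt => /negP[].
(* With d the size of the complement of [C]: (B+1)^d <= (cN)^d = c^d N^d < N^(d+1) <= N^l. *)
apply: (@leq_ltn_trans ((c * N) ^ #|~: C|)%N).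
  have BcN : (B.+1 <= c * N)%N by rewrite /B /c; lia.
  by case: #|~: C| => // d; rewrite leq_exp2r.
rewrite expnMn; apply: (@leq_trans (N ^ #|~: C|.+1)%N).
  by rewrite expnS ltn_mul2r expn_gt0 /= /N.
by rewrite leq_pexp2l.
Qed.

(** * Chains of primes in a quotient ring *)

Section IdealQuotient.
Variables (R : comNzRingType) (J : idealr R).
Local Notation Q := {ideal_quot J}.
Local Notation pi := (\pi_Q)%qT.

(** The two elements differ by an element of [J], hence of [P]. Primes above [J] can thus be read on
    representatives. *)
Lemma mem_repr_pi (P : {pred R}) x : idealr_closed P -> {subset J <= P} ->
  (repr (pi x) \in P) = (x \in P).
Proof.
move=> idlP sJP.
have eJ : x - repr (pi x) \in J by rewrite Quotient.idealrBE reprK.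
have eJ' : repr (pi x) - x \in J by rewrite Quotient.idealrBE reprK.
by apply/idP/idP => [rP|xP];
  [rewrite -(subrK (repr (pi x)) x) | rewrite -(subrK x (repr (pi x)))];
  apply: (idealr_closedD idlP) => //; apply: sJP.
Qed.

(** Serves the lower bound on the dimension; the two lemmas after it serve the upper bound. *)
Lemma prime_chain_ideal_quot (d : nat) (P : nat -> {pred R}) :
    prime_chain d P -> (forall i, (i <= d)%N -> {subset J <= P i}) ->
  exists P' : nat -> {pred Q}, prime_chain d P'.
Proof.
move=> [prP chainP] JP.
pose P' i : {pred Q} := [pred q | repr q \in P i].
have P'E i x : (i <= d)%N -> (pi x \in P' i) = (x \in P i).
  by move=> id; apply: mem_repr_pi (JP i id); have [] := prP i id.
exists P'; split=> [i id|i id].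
  have [[P0 P1 Plin] Ppr] := prP i id; split; first split.
  - by rewrite -[0](rmorph0 pi) P'E.
  - by rewrite -[1](rmorph1 pi) P'E.
  - move=> a u v; rewrite -[a]reprK -[u]reprK -[v]reprK.
    by rewrite -rmorphM -rmorphD !P'E //; apply: Plin.
  - move=> u v; rewrite -[u]reprK -[v]reprK.
    by rewrite -rmorphM !P'E //; apply: Ppr.
have [sP [x xP xNP]] := chainP i id; split; first by move=> q; apply: sP.
by exists (pi x); rewrite P'E // ltnW.
Qed.

Lemma prime_chain_preim (d : nat) (P : nat -> {pred Q}) :
    prime_chain d P ->
  prime_chain d (fun i => [pred x | pi x \in P i] : {pred R}).
Proof.
move=> [prP chainP]; split=> [i id|i id].
  have [[P0 P1 Plin] Ppr] := prP i id; split; first split.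
  - by rewrite inE rmorph0.
  - by rewrite inE rmorph1.
  - by move=> a u v; rewrite !inE rmorphD rmorphM; apply: Plin.
  - by move=> u v; rewrite !inE rmorphM; apply: Ppr.
have [sP [x xP xNP]] := chainP i id; split; first by move=> q; apply: sP.
by exists (repr x); rewrite inE reprK.
Qed.

Lemma prime_chain_preim_sub (d : nat) (P : nat -> {pred Q}) :
  prime_chain d P -> {subset J <= [pred x | pi x \in P 0%N]}.
Proof.
move=> [/(_ 0%N isT)[[P0 _ _] _] _] x xJ; rewrite inE.
suff -> : pi x = pi 0 by rewrite rmorph0.
by apply/eqP; rewrite -Quotient.idealrBE subr0.
Qed.

End IdealQuotient.

(** * Primes generated by variables *)

Section CoordinateIdeals.
Variables (K : fieldType) (n : nat).
Implicit Types (C D : {set 'I_n}).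

Definition coord_eval C : {mpoly K[n]} -> {mpoly K[n]} :=
  comp_mpoly [tuple if i \in C then 0 else 'X_i | i < n].

(** This is the ideal generated by the variables in [C]; as the kernel of a map to a domain it is
    visibly prime. *)
Definition coord_ideal C : {pred {mpoly K[n]}} := [pred p | coord_eval C p == 0].

Lemma coord_ideal_prime C : prime_ideal (coord_ideal C).
Proof.
split; first split; rewrite ?inE /coord_eval ?rmorph0 ?rmorph1 ?oner_eq0 //.
  move=> a u v; rewrite !inE /coord_eval rmorphD rmorphM => /eqP u0 /eqP v0.
  by rewrite /= u0 v0 mulr0 addr0.
by move=> u v; rewrite !inE /coord_eval rmorphM mulf_eq0.
Qed.

Lemma coord_idealX C m :
  ('X_[m] \in coord_ideal C) = [exists i in C, (0 < m i)%N].
Proof.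
rewrite inE /coord_eval comp_mpolyX.
apply/idP/exists_inP => [/prodf_eq0[i _]|[i iC mi]].
  rewrite expf_eq0 tnth_mktuple => /andP[mi]; case: ifP => [iC _|_]; first by exists i.
  by move=> /eqP/mpolyP/(_ U_(i)%MM); rewrite mcoeffX mcoeff0 eqxx => /eqP; rewrite oner_eq0.
by apply/prodf_eq0; exists i; rewrite // tnth_mktuple iC expf_eq0 mi /=.
Qed.

Lemma coord_idealXU C i : ('X_i \in coord_ideal C) = (i \in C).
Proof.
rewrite coord_idealX; apply/exists_inP/idP => [[j jC]|iC].
  by rewrite mnm1E; case: eqP => // ->.
by exists i; rewrite // mnm1E eqxx.
Qed.

(** Setting the variables of [D] to 0 factors through setting those of [C] to 0. *)
Lemma coord_ideal_subset C D : C \subset D -> {subset coord_ideal C <= coord_ideal D}.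
Proof.
move=> /subsetP sCD p; rewrite !inE => /eqP p0.
suff -> : coord_eval D p = coord_eval D (coord_eval C p) by rewrite p0 /coord_eval rmorph0.
rewrite /coord_eval !(comp_mpolyEX p) raddf_sum; apply: eq_bigr => m _ /=.
rewrite comp_mpolyZ; congr (_ *: _); rewrite !comp_mpolyX rmorph_prod.
apply: eq_bigr => i _; rewrite rmorphXn !tnth_mktuple /=; congr (_ ^+ _).
have [iC|_] := boolP (i \in C); first by rewrite (sCD _ iC) rmorph0.
by rewrite comp_mpolyXU -tnth_nth tnth_mktuple.
Qed.

Lemma coord_ideal_chain C : exists P : nat -> {pred {mpoly K[n]}},
  prime_chain #|~: C| P /\ forall i, {subset coord_ideal C <= P i}.
Proof.
pose s := enum (~: C).
pose D i := C :|: [set j in take i s].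
exists (fun i => coord_ideal (D i)); split; last first.
  by move=> i; apply/coord_ideal_subset/subsetUl.
split=> [i _|i iC]; first exact: coord_ideal_prime.
have i_s : (i < size s)%N by rewrite -cardE.
have x0 : 'I_n by case: (s) i_s.
have DS : D i.+1 = nth x0 s i |: D i.
  apply/setP => j; rewrite !inE (take_nth x0) // mem_rcons inE.
  by rewrite orbCA.
split; first by apply: coord_ideal_subset; rewrite DS subsetUr.
exists 'X_(nth x0 s i); first by rewrite coord_idealXU DS !inE eqxx.
have := mem_nth x0 i_s; rewrite coord_idealXU mem_enum !inE => /negPf-> /=.
(* The enumeration has no repetition, so its entry at position [i] is not among the first [i]
   ones. *)
have := enum_uniq (~: C); rewrite -/s -[in uniq _](cat_take_drop i s) (drop_nth x0) //.
by rewrite cat_uniq /= negb_or => /and3P[_ /andP[]].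
Qed.

End CoordinateIdeals.

(** * Ideals defined by the weight of monomials *)

Section WeightIdeals.
Variables (K : fieldType) (n : nat).
Implicit Types (T : {set 'I_n}) (I : {pred {mpoly K[n]}}).

Definition weight T (m : 'X_{1..n}) : nat := (\sum_(i in T) m i)%N.

(** This is the [a]-th power of the ideal generated by the variables in [T]. *)
Definition weight_ideal T a : {pred {mpoly K[n]}} :=
  [pred p | all (fun m => a <= weight T m)%N (msupp p)].

Lemma weightD T m1 m2 : weight T (m1 + m2)%MM = (weight T m1 + weight T m2)%N.
Proof. by rewrite -big_split; apply: eq_bigr => i _; rewrite mnmDE. Qed.

Lemma weight_idealX T a m : ('X_[m] \in weight_ideal T a) = (a <= weight T m)%N.
Proof. by rewrite inE msuppX /= andbT. Qed.

Lemma weight_idealM T a b p q : p \in weight_ideal T a -> q \in weight_ideal T b ->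
  p * q \in weight_ideal T (a + b).
Proof.
move=> /allP pa /allP qb; apply/allP => m.
move=> /msuppM_le/allpairsP[[m1 m2] /= [m1p m2q ->]].
by rewrite weightD leq_add ?pa ?qb.
Qed.

(** [idealr_closed] includes properness, whence the positivity of [a]. *)
Lemma weight_ideal_closed T a : (0 < a)%N -> idealr_closed (weight_ideal T a).
Proof.
move=> a0; split; first by rewrite inE msupp0.
  rewrite inE msupp1 /= andbT -ltnNge /weight big1 // => i _.
  by rewrite mnm0E.
move=> p u v uT vT; apply/allP => m /msuppD_le; rewrite mem_cat => /orP[].
  by move: m; apply/allP; rewrite -[a]add0n; apply: weight_idealM => //; apply/allP.
by move: m; apply/allP.
Qed.

(** Used with [a = 1] on the last vertices of the blocks, and with [a = t] on all vertices, where
    the weight is the degree. *)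
Lemma ideal_exp_weight T I a k : (0 < a)%N -> (0 < k)%N ->
  {subset I <= weight_ideal T a} -> {subset ideal_exp I k <= weight_ideal T (k * a)}.
Proof.
move=> a0 k0 sI; apply: ideal_span_min.
  by apply: weight_ideal_closed; rewrite muln_gt0 k0.
move=> _ /asboolP[s sP ->]; rewrite -[X in (X * a)%N](size_tuple s).
elim: (tval s) sP => [_|f r IHr /= /andP[fI /IHr rT]].
  by rewrite big_nil mul0n; apply/allP.
by rewrite big_cons mulSn; apply: weight_idealM => //; apply: sI.
Qed.

Definition set_mnm (F : {set 'I_n}) : 'X_{1..n} := [multinom (j \in F : nat) | j < n].

Lemma weight_set_mnm T F : weight T (set_mnm F) = #|T :&: F|.
Proof.
rewrite /weight -sum1_card big_mkcond [RHS]big_mkcond; apply: eq_bigr => i _.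
by rewrite mnmE inE; do !case: (i \in _).
Qed.

Lemma mdeg_weight m : mdeg m = weight setT m.
Proof. by rewrite mdegE /weight; apply: eq_bigl => i; rewrite inE. Qed.

Lemma prod_set_mnm (F : {set 'I_n}) : \prod_(j in F) 'X_j = 'X_[set_mnm F] :> {mpoly K[n]}.
Proof.
rewrite mpolyXE_id big_mkcond; apply: eq_bigr => i _.
by rewrite mnmE; case: ifP.
Qed.

End WeightIdeals.

Lemma subset_of_card (T : finType) (A : {set T}) c : (c <= #|A|)%N ->
  exists2 B : {set T}, B \subset A & #|B| = c.
Proof.
move=> /card_geqP[s [us <- sA]]; exists [set x in s].
  by apply/subsetP => x; rewrite inE; apply: sA.
by rewrite cardsE; apply/card_uniqP.
Qed.

(** * Facets of the path complex and blocks *)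

Section PathFacets.
Variables (n t : nat).
Hypothesis t_gt0 : (0 < t)%N.
Local Notation q := (n %/ t)%N.

Lemma card_path_facet i : (i < n.+1 - t)%N -> #|path_facet n t i| = t.
Proof.
move=> it; have lt_n (s : 'I_t) : (i + s < n)%N by have := ltn_ord s; lia.
have inj : injective (fun s => Ordinal (lt_n s)).
  by move=> s s' [/addnI eqs]; apply: val_inj.
rewrite -[RHS]card_ord -(card_codom inj) -cardsE; apply: eq_card => j.
rewrite !inE; apply/idP/codomP => [/andP[ij jit]|[s ->] /=]; last first.
  by rewrite leq_addr ltn_add2l ltn_ord.
have st : (j - i < t)%N by lia.
by exists (Ordinal st); apply: val_inj; rewrite /= subnKC.
Qed.

(** Disjoint facets of [t] vertices each cover at most [n] vertices. *)
Lemma matching_number_path_le : (matching_number (path_complex n t) <= q)%N.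
Proof.
apply/bigmax_leqP => M /andP[/subsetP Mfac trM].
rewrite leq_divRL // -[X in (_ <= X)%N](card_ord n).
apply: leq_trans (max_card (mem (cover M))); rewrite -(eqP trM).
rewrite -sum_nat_const leq_sum // => F /Mfac; rewrite inE => /maxsetP[].
move=> Fpc Fmax; have: F \in path_complex n t := Fpc.
(* A maximal face equals the interval [G] that contains it. *)
rewrite inE => /exists_inP[G Gfac FG].
have GM : G \in path_complex n t by rewrite inE; apply/exists_inP; exists G.
rewrite -(Fmax G GM FG); case/imsetP: Gfac => i _ ->.
by rewrite card_path_facet // ltn_ord.
Qed.

Lemma block_start_lt (s : 'I_q) : (s * t < n.+1 - t)%N.
Proof.
have : (s.+1 * t <= n)%N by rewrite -leq_divRL.
by rewrite mulSn; lia.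
Qed.

(** The block of a vertex is a quotient, so distinct blocks are disjoint. *)
Lemma mem_block (s : 'I_q) (j : 'I_n) : (j \in path_facet n t (s * t)) = (j %/ t == s)%N.
Proof.
by rewrite inE eqn_leq andbC leq_divRL // -(ltnS (j %/ t)%N) ltn_divLR // mulSn addnC.
Qed.

Definition last_in_block (s : 'I_q) : 'I_n.
Proof.
apply: (@Ordinal n (s * t + t.-1)).
by have := block_start_lt s; lia.
Defined.

Lemma last_in_block_inj : injective last_in_block.
Proof.
move=> s s' [/addIn/eqP]; rewrite eqn_pmul2r // => /eqP; exact: val_inj.
Qed.

(** The last vertex of the block containing [i] comes at most [t - 1] places after [i]. *)
Lemma path_facet_last_in_block i : (i < n.+1 - t)%N ->
  exists s, last_in_block s \in path_facet n t i.
Proof.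
move=> it; have iq : (i %/ t < q)%N.
  by rewrite leq_divRL // mulSn; have := leq_divM i t; lia.
exists (Ordinal iq); rewrite inE /=.
have := divn_eq i t; have := ltn_pmod i t_gt0; lia.
Qed.

End PathFacets.

(** * Squarefree powers of the path ideal *)

Section PathIdealPower.
Variables (K : fieldType) (n t k : nat).
Hypotheses (t_gt0 : (0 < t)%N) (k_gt0 : (0 < k)%N).
Local Notation q := (n %/ t)%N.
Local Notation I := (@path_ideal K n t).

Lemma path_ideal_weight (T : {set 'I_n}) a : (0 < a)%N ->
    (forall i, (i < n.+1 - t)%N -> (a <= #|T :&: path_facet n t i|)%N) ->
  {subset I <= weight_ideal T a}.
Proof.
move=> a0 aT; apply: ideal_span_min; first exact: weight_ideal_closed.
move=> _ /existsP[i /eqP->].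
by rewrite prod_set_mnm weight_idealX weight_set_mnm aT.
Qed.

Lemma squarefree_power_sub_coord_ideal (A : {set 'I_q}) : (q < #|A| + k)%N ->
  {subset squarefree_power I k <= coord_ideal (last_in_block t_gt0 @: A)}.
Proof.
move=> qA; have [idC _] := coord_ideal_prime K (last_in_block t_gt0 @: A).
apply: ideal_span_min => // _ /asboolP[m [/asboolP[mI _] /forallP sqm ->]].
set C := _ @: A; pose T := last_in_block t_gt0 @: [set: 'I_q].
have cardT : #|T| = q by rewrite card_imset ?cardsT ?card_ord //; apply: last_in_block_inj.
have cardC : #|C| = #|A| by rewrite card_imset //; apply: last_in_block_inj.
have CT : C \subset T by apply/imsetS/subsetT.
have : 'X_[m] \in weight_ideal (K := K) T (k * 1).
  apply: ideal_exp_weight mI => //; apply: path_ideal_weight => // i it.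
  have [s sF] := path_facet_last_in_block t_gt0 it.
  by apply/card_gt0P; exists (last_in_block t_gt0 s); rewrite inE sF imset_f.
rewrite weight_idealX muln1 coord_idealX; apply: contraTT.
rewrite negb_exists_in -ltnNge => /forall_inP mC0.
(* If [m] avoids [C], its weight comes from [T :\: C]; exponents being at most 1, it is at most
   [q - #|A|], below [k]. *)
rewrite /weight (big_setID C) /= (setIidPr CT) big1 ?add0n => [|i iC]; last first.
  by apply/eqP; rewrite -leqn0 leqNgt mC0.
apply: (@leq_ltn_trans #|T :\: C|).
  by rewrite -sum1_card leq_sum.
by have := cardsDS CT; lia.
Qed.

(** Disjointness of the blocks makes the product squarefree; its degree [k * t], the least possible
    in the ordinary power, makes it a minimal generator. *)
Lemma prod_blocks_in_squarefree_power (A : {set 'I_q}) : #|A| = k ->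
  \prod_(s in A) 'X_[set_mnm (path_facet n t (s * t))] \in squarefree_power I k.
Proof.
move=> cardA; pose m := (\sum_(s in A) set_mnm (path_facet n t (s * t)))%MM.
have prodE : \prod_(s in A) 'X_[set_mnm (path_facet n t (s * t))] = 'X_[m] :> {mpoly K[n]}.
  by rewrite /m; elim/big_rec2: _ => [|s p f _ ->]; rewrite ?mpolyX0 ?mpolyXD.
have facetI (s : 'I_q) : 'X_[set_mnm (path_facet n t (s * t))] \in I.
  apply: mem_ideal_span; apply/existsP.
  by exists (Ordinal (block_start_lt t_gt0 s)); rewrite prod_set_mnm.
rewrite prodE; apply: mem_ideal_span; apply/asboolP; exists m; split=> //; last first.
  apply/forallP => i; rewrite mnm_sumE.
  have [/existsP[s /andP[sA si]]|/existsPn no_s] :=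
      boolP [exists s in A, i \in path_facet n t (s * t)].
    rewrite (bigD1 s) //= mnmE si big1 // => s' /andP[s'A s's].
    rewrite mnmE; move: si; rewrite !mem_block // => /eqP->.
    by rewrite val_eqE eq_sym (negPf s's).
  by rewrite big1 // => s sA; have := no_s s; rewrite sA mnmE => /= /negPf->.
apply/asboolP; split.
  apply: mem_ideal_span; apply/asboolP; rewrite -prodE.
  have sz : size [seq 'X_[set_mnm (path_facet n t (s * t))] : {mpoly K[n]} | s : 'I_q <- enum A] == k.
    by rewrite size_map -cardE cardA.
  exists (Tuple sz); first by apply/allP => _ /mapP[s _ ->]; apply: facetI.
  by rewrite big_map big_enum.
move=> m' m'I /mnm_lepP m'm.
have mdm : mdeg m = (k * t)%N.
  rewrite mdeg_sum (eq_bigr (fun=> t)) ?sum_nat_const ?cardA // => s _.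
  rewrite mdeg_weight weight_set_mnm setTI card_path_facet //.
  exact: block_start_lt.
have : 'X_[m'] \in weight_ideal (K := K) setT (k * t).
  apply: ideal_exp_weight m'I => //; apply: path_ideal_weight => // i it.
  by rewrite setTI card_path_facet.
rewrite weight_idealX -mdeg_weight -mdm !mdegE => mm'.
(* Exponents of [m'] are bounded by those of [m] and have the same sum, so they agree one by one. *)
have [_] := leqif_sum (fun i (_ : true) => leqif_eq (m'm i)).
rewrite eqn_leq mm' leq_sum // => /esym/forallP eqm.
by apply/mnmP => i; apply/eqP/eqm.
Qed.

Lemma card_vars_prime (P : {pred {mpoly K[n]}}) : (0 < q)%N ->
    prime_ideal P -> {subset squarefree_power I k <= P} ->
  (q < #|[set i | 'X_i \in P]| + k)%N.
Proof.
move=> q_gt0 primeP sIP; set C := [set i | _].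
pose H := [set s : 'I_q | [disjoint C & path_facet n t (s * t)]].
(* The product of [k] blocks lies in [P], so by primality one of these blocks has a variable in
   [P]. *)
have Hk : (#|H| < k)%N.
  rewrite ltnNge; apply/negP => /subset_of_card[A AH cardA].
  have /sIP/(prime_ideal_prod primeP)[s sA] := prod_blocks_in_squarefree_power cardA.
  rewrite -prod_set_mnm => /(prime_ideal_prod primeP)[i iF iP].
  have := subsetP AH s sA; rewrite inE => /disjoint_setI0/setP/(_ i).
  by rewrite !inE iP; move: iF; rewrite inE => ->.
have : (#|~: H| <= #|C|)%N.
  (* Each vertex is sent to its block, and vertices past the last full block to block 0; the image
     of [C] contains every block that meets [C]. *)
  apply: leq_trans (leq_imset_card (fun i : 'I_n => insubd (Ordinal q_gt0) (i %/ t)%N) _).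
  apply/subset_leq_card/subsetP => s; rewrite !inE => /pred0Pn[i /= /andP[iC]].
  rewrite mem_block // => /eqP si; apply/imsetP; exists i => //.
  by apply: val_inj; rewrite val_insubd si ltn_ord.
have := cardsC H; rewrite card_ord; lia.
Qed.

End PathIdealPower.

(* The dimension formula *)
Local Close Scope ring_scope.

Theorem theorem4p12 (K : fieldType) (n t k : nat)
    (t_gt0 : 0 < t) (t_le_n : t <= n)
    (k_gt0 : 0 < k) (k_le_nu : k <= matching_number (path_complex n t)) :
  is_krull_dim {ideal_quot (path_squarefree_power K n t_gt0 k_gt0)}
    (n - n %/ t + k - 1).
Proof.
have kq : (k <= n %/ t) := leq_trans k_le_nu (matching_number_path_le n t_gt0).
have qn : (n %/ t <= n) := leq_div n t.
split.
  (* This is the least size with [n %/ t < #|A| + k], so it leaves the most variables for the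
     chain. *)
  have [|A _ cardA] := @subset_of_card _ [set: 'I_(n %/ t)] (n %/ t - k + 1).
    by rewrite cardsT card_ord; lia.
  have [P [chainP sP]] := coord_ideal_chain K (last_in_block t_gt0 @: A).
  have -> : (n - n %/ t + k - 1) = #|~: (last_in_block t_gt0 @: A)|.
    have := cardsC (last_in_block t_gt0 @: A); rewrite card_ord.
    rewrite card_imset ?cardA; last exact: last_in_block_inj.
    move: #|~: _| => d; lia.
  apply: (prime_chain_ideal_quot chainP) => i _ f fI; apply: sP.
  by apply: squarefree_power_sub_coord_ideal fI => //; lia.
move=> m P chainP.
(* Pulled back, the chain starts at a prime above the squarefree power, which contains at least
   [n %/ t - k + 1] variables. *)
have chainP' := prime_chain_preim chainP.
have sP := prime_chain_preim_sub chainP.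
set P' := fun i => _ in chainP'.
have prP' : prime_ideal (P' 0) by case: chainP' => /(_ 0 isT).
have q_gt0 : (0 < n %/ t) by rewrite divn_gt0.
have := card_vars_prime t_gt0 k_gt0 q_gt0 prP' sP.
set C := [set i | _]; have := cardsC C; rewrite card_ord.
have : (m <= #|~: C|) by apply: chain_length_le chainP' _ => i; rewrite inE.
move: #|~: C| #|C| => a b; lia.
Qed.
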